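(* Let $D=\{(x_n,y_n)\}_{n=1}^{N}$ be a dataset with inputs $x_n\in\mathbb{R}^d$ and outputs $y_n\in\mathbb{R}$, and let $\Phi^{\mathcal B}(D)(\cdot)$ be the Bayesian convolutional deep set representation defined in the context. If $\Phi^{\mathcal B}(D)(\cdot)$ is defined on the finite grid points, then $\Phi^{\mathcal B}(D)(\cdot)$ is translation equivariant in the distribution sense, i.e., for translations $\tau\in\mathbb{R}^d$, $$\Phi^{\mathcal B}\circ (T_\tau(D)) \stackrel{d}{=} T^*_\tau\circ\big(\Phi^{\mathcal B}(D)\big),$$ where $\stackrel{d}{=}$ denotes equality in distribution.
   Context: **Translations.** For $D=((x_1,y_1),\dots,(x_N,y_N))$ and $\tau\in\mathbb{R}^d$, $T_\tau(D)=((x_1+\tau,y_1),\dots,(x_N+\tau,y_N))$. For a function $h$ on $\mathbb{R}^d$, $T^*_\tau(h(\cdot))=h(\cdot-\tau)$. A (deterministic) map $\Phi$ from datasets to functions on $\mathbb{R}^d$ is called translation equivariant if $\Phi\circ(T_\tau(D))=T^*_\tau\circ(\Phi(D))$. **Stationary kernels.** For $q=1,\dots,Q$, $p_q(s)=N(s;\mu_q,\mathrm{Diag}(\Sigma_q))$ is a Gaussian spectral density on $\mathbb{R}^d$, ordered so that $\mu_1=0$ and $\mu_1\le\dots\le\mu_Q$ elementwise, with associated stationary kernel $k_q(r)=\int_{\mathbb{R}^d}\cos(2\pi s^{T}r)\,p_q(s)\,ds$. **Categorical latent variable.** $\mathrm{p}_{\mathrm{nn}}$ is a neural network mapping datasets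 to the probability simplex $\Delta^{Q-1}$ that is translation invariant, $\mathrm{p}_{\mathrm{nn}}(T_\tau(D))=\mathrm{p}_{\mathrm{nn}}(D)$. The latent variable $Z_{\mathrm{cat}}=(z_1,\dots,z_Q)$ is sampled from $\mathrm{Cat}(Z_{\mathrm{cat}};\mathrm{p}_{\mathrm{nn}}(D))$ (in practice by the Gumbel-softmax trick). **Random stationary functions.** For each $q$, sample $w_{q,i}\sim N(0,1)$, $s_{q,i}\sim p_q(s)$, $b_{q,i}\sim U[0,2\pi]$ for $i=1,\dots,l$ and set $$\phi_q(\cdot)=\sqrt{\tfrac{2}{l}}\sum_{i=1}^{l}w_{q,i}\cos\big(2\pi\langle s_{q,i},\cdot\rangle+b_{q,i}\big).$$ **Expected kernel.** $k(r)=\mathbb{E}\big[\sum_{q=1}^{Q}z_q k_q(r)\big]$, the expectation being over $Z_{\mathrm{cat}}\sim\mathrm{Cat}(\mathrm{p}_{\mathrm{nn}}(D))$. **Random data representation.** With $X=(x_n)_{n=1}^N$, $Y=(y_n)_{n=1}^N\in\mathbb{R}^N$, Gram matrix $K(X,X)=[k(x_n-x_m)]_{n,m}$, noise variance $\sigma_\epsilon^2$, and $\Psi(X)=\big(\sum_{q=1}^{Q}\sqrt{z_q}\,\phi_q(x_n)\big)_{n=1}^N$, put $$v_n=\big[(K(X,X)+\sigma_\epsilon^2 I)^{-1}(Y-\Psi(X))\big]_n,\qquad f(D)(\cdot)=\sum_{q=1}^{Q}\sqrt{z_q}\,\phi_q(\cdot)+\sum_{n=1}^{N}v_n\,k(\cdot-x_n).$$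 **Bayesian convolutional deep set.** The random functional representation and the Bayesian convolutional deep set are $$RE(D)(\cdot)=\Big[\sum_{n=1}^{N}k(\cdot-x_n),\ f(D)(\cdot)\Big],\qquad \Phi^{\mathcal B}(D)(\cdot)=\rho\circ RE(D)(\cdot),$$ where $\rho$ is a continuous and translation equivariant mapping, parameterized by a convolutional neural network. **Finite grid points.** In the model, the representation is evaluated on finitely many discretized inputs $\{t_m\}_{m=1}^{M}$, obtained by linearly spacing the range of the inputs, as $\Phi^{\mathcal B}(D)(t_m)=(\rho\circ RE(D))(t_m)$, $m=1,\dots,M$. *)

(* Defs.v *)
(* MathComp-Analysis. *)
From HB Require Import structures.
From mathcomp Require Import all_boot all_order all_algebra finmap.
From mathcomp Require Import all_classical all_reals all_analysis.

Set Implicit Arguments.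
Unset Strict Implicit.
Unset Printing Implicit Defensive.

Import Order.TTheory GRing.Theory Num.Theory.
Import numFieldNormedType.Exports.

Local Open Scope classical_set_scope.
Local Open Scope ring_scope.

(* Points of R^d at which functions are evaluated live in 'rV[R]_d (which
   carries the topology); random vectors live in n.-tuple R (which carries the
   product sigma-algebra, i.e. the Borel sets of R^n). *)

Section lebesgue_measure_Rn.
Context {R : realType}.

(* [measurableTypeR R] is the copy of R on which [lebesgue_measure] lives. *)
Definition tcons n (xs : measurableTypeR R * n.-tuple R) : n.+1.-tuple R :=
  [tuple of (xs.1 : R) :: xs.2].

Definition tuncons n (t : n.+1.-tuple R) : measurableTypeR R * n.-tuple R :=
  (thead t, [tuple of behead t]).

Lemma tconsK n : cancel (@tcons n) (@tuncons n).
Proof. by case=> x s; congr pair; apply: val_inj. Qed.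

Lemma measurable_tcons n : measurable_fun setT (@tcons n).
Proof.
apply: (@measurable_cons _ _ (measurableTypeR R * n.-tuple R)%type R fst n snd).
  exact: measurable_fst.
exact: measurable_snd.
Qed.

Lemma measurable_tuncons n : measurable_fun setT (@tuncons n).
Proof.
apply/measurable_fun_pairP; split; last exact: measurable_behead.
exact: (@measurable_tnth _ R).
Qed.

Definition lebesgue_step n
    (m : {sigma_finite_measure set (n.-tuple R) -> \bar R}) :=
  pushforward (@lebesgue_measure R \x m)%E (@tcons n).

Section step.
Variables (n : nat) (m : {sigma_finite_measure set (n.-tuple R) -> \bar R}).

Let stepM : {measure set (n.+1.-tuple R) -> \bar R} :=
  measure_function_pushforward__canonical__measure_function_Measure
    (lebesgue_measure \x m)%E (@measurable_tcons n).

HB.instance Definition _ := isMeasure.Build _ _ _ (lebesgue_step m)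
  (measure0 stepM) (measure_ge0 stepM) (@measure_semi_sigma_additive _ _ _ stepM).

Let step_sigma_finite : sigma_finite setT (lebesgue_step m).
Proof.
have /sigma_finiteP[F [FT ndF Foo]] := sigma_finiteT (@lebesgue_measure R).
have /sigma_finiteP[G [GT ndG Goo]] := sigma_finiteT m.
have mFG i : measurable (F i `*` G i).
  by apply: measurableX; [case: (Foo i)|case: (Goo i)].
exists (fun i => @tuncons n @^-1` (F i `*` G i)).
  apply/seteqP; split => // t _.
  have [i _ Fi] : (\bigcup_i F i) (thead t) by rewrite -FT.
  have [j _ Gj] : (\bigcup_i G i) [tuple of behead t] by rewrite -GT.
  exists (maxn i j) => //; split => /=.
    by move: Fi; apply/subsetPset/ndF/leq_maxl.
  by move: Gj; apply/subsetPset/ndG/leq_maxr.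
move=> i; split.
  by rewrite -[X in measurable X]setTI; exact: measurable_tuncons.
rewrite /lebesgue_step /pushforward -comp_preimage (_ : _ \o _ = id); last first.
  by apply/funext => x /=; rewrite tconsK.
have [mFi Fi] := Foo i; have [mGi Gi] := Goo i.
by rewrite preimage_id product_measure1E// lte_mul_pinfty// ge0_fin_numE.
Qed.

HB.instance Definition _ :=
  Measure_isSigmaFinite.Build _ _ _ (lebesgue_step m) step_sigma_finite.

End step.

Fixpoint lebesgue_tuple n : {sigma_finite_measure set (n.-tuple R) -> \bar R} :=
  match n with
  | 0 => dirac [tuple]
  | n'.+1 => lebesgue_step (lebesgue_tuple n')
  end.

End lebesgue_measure_Rn.

Section probability_notions.
Context {R : realType}.

Definition has_law d d' (T : measurableType d) (P : probability T R)
    (T' : measurableType d') (X : {RV P >-> T'}) (L : set T' -> \bar R) : Prop :=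
  forall A, measurable A -> distribution P X A = L A.

Definition sigma_of d d' (T : measurableType d) (P : probability T R)
    (T' : measurableType d') (X : {RV P >-> T'}) : set (set T) :=
  preimage_set_system setT X measurable.

Definition mutually_independent d (T : measurableType d) (P : probability T R)
    (I : choiceType) (G : I -> set (set T)) : Prop :=
  forall (J : {fset I}) (E : I -> set T), (forall i, i \in J -> G i (E i)) ->
    P (\bigcap_(i in [set` J]) E i) = (\prod_(i <- J) P (E i))%E.

(* Measurability is part of the claim: the value of [P1] or [P2] on a
   non-measurable preimage would carry no meaning. *)
Definition eq_in_distribution d1 d2 d' (T1 : measurableType d1)
    (T2 : measurableType d2) (P1 : probability T1 R) (P2 : probability T2 R)
    (T' : measurableType d') (X : T1 -> T') (Y : T2 -> T') : Prop :=
  [/\ measurable_fun setT X, measurable_fun setT Y &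
      forall A, measurable A -> pushforward P1 X A = pushforward P2 Y A].

(* Density of N(mu, Diag Sigma): the entries of Sigma are the variances, while
   the second parameter of [normal_pdf] is a standard deviation. *)
Definition gauss_pdf d (mu Sigma : 'rV[R]_d) (s : d.-tuple R) : R :=
  \prod_(j < d) normal_pdf (mu 0 j) (Num.sqrt (Sigma 0 j)) (tnth s j).

Definition gauss_prob d (mu Sigma : 'rV[R]_d) (A : set (d.-tuple R)) : \bar R :=
  (\int[lebesgue_tuple d]_(s in A) (gauss_pdf mu Sigma s)%:E)%E.

(* The law Cat(p) of a one-hot vector z, with P(z = e_q) = p q. *)
Definition onehot Q (q : 'I_Q) : Q.-tuple R := [tuple (q == j)%:R | j < Q].

Definition cat_prob Q (p : 'I_Q -> R) (A : set (Q.-tuple R)) : \bar R :=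
  (\sum_(q < Q) (p q)%:E * \d_(onehot q) A)%E.

Lemma twopi_gt0 : 0 < 2 * pi :> R.
Proof. by rewrite mulr_gt0 ?pi_gt0. Qed.

End probability_notions.

Section translations.
Context {R : realType}.

Definition dataset (d N : nat) := N.-tuple ('rV[R]_d * R).

Definition translate d N (tau : 'rV[R]_d) (D : dataset d N) : dataset d N :=
  [tuple of [seq (xy.1 + tau, xy.2) | xy <- D]].

Definition translate_fun d (V : Type) (tau : 'rV[R]_d) (h : 'rV[R]_d -> V) :
    'rV[R]_d -> V :=
  fun x => h (x - tau).

End translations.
Arguments dataset : clear implicits.

(* Deterministic parameters: Q spectral densities on R^d, and c output channels
   of the convolutional network [rho]. *)
Record bcds_model (R : realType) (d Q c : nat) := BcdsModel {
  spec_mean : 'I_Q -> 'rV[R]_d;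
  spec_var : 'I_Q -> 'rV[R]_d;
  noise_var : R;
  p_nn : forall N, dataset R d N -> 'I_Q -> R;
  rho : ('rV[R]_d -> 'rV[R]_2) -> ('rV[R]_d -> 'rV[R]_c);

  spec_mean_first : forall q : 'I_Q, q = 0%N :> nat -> spec_mean q = 0;
  spec_mean_sorted : forall (q q' : 'I_Q) (j : 'I_d), (q <= q')%N ->
    spec_mean q 0 j <= spec_mean q' 0 j;
  spec_var_gt0 : forall (q : 'I_Q) (j : 'I_d), 0 < spec_var q 0 j;
  noise_var_gt0 : 0 < noise_var;
  p_nn_ge0 : forall N (D : dataset R d N) q, 0 <= p_nn D q;
  p_nn_sum1 : forall N (D : dataset R d N), \sum_(q < Q) p_nn D q = 1;
  p_nn_translate : forall N (D : dataset R d N) tau,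
    p_nn (translate tau D) = p_nn D;
  (* rho acts on continuous functions; continuity is for uniform convergence on
     compact sets. *)
  rho_continuous :
    {within [set h : {family compact, 'rV[R]_d -> 'rV[R]_2} |
               continuous (h : 'rV[R]_d -> 'rV[R]_2)],
      continuous (rho : {family compact, 'rV[R]_d -> 'rV[R]_2} ->
                        {family compact, 'rV[R]_d -> 'rV[R]_c})};
  rho_translate : forall tau (h : 'rV[R]_d -> 'rV[R]_2), continuous h ->
    rho (translate_fun tau h) = translate_fun tau (rho h)
}.

(* Sampled quantities: Z_cat, w_{q,i}, s_{q,i} and b_{q,i} respectively. *)
Record bcds_noise (R : realType) (disp : measure_display)
    (T : measurableType disp) (P : probability T R) (d Q l : nat) := BcdsNoise {
  latent : {RV P >-> Q.-tuple R};
  weight : 'I_Q -> 'I_l -> {RV P >-> R};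
  freq : 'I_Q -> 'I_l -> {RV P >-> d.-tuple R};
  phase : 'I_Q -> 'I_l -> {RV P >-> R}
}.

Section bayesian_conv_deep_set.
Context {R : realType} {d Q c : nat} (m : bcds_model R d Q c).

Definition inner (s : d.-tuple R) (x : 'rV[R]_d) : R :=
  \sum_(j < d) tnth s j * x 0 j.

Definition kq (q : 'I_Q) (r : 'rV[R]_d) : R :=
  fine (\int[lebesgue_tuple d]_s
          (cos (2 * pi * inner s r) *
           gauss_pdf (spec_mean m q) (spec_var m q) s)%:E)%E.

Context {disp : measure_display} {T : measurableType disp}
  {P : probability T R} {l : nat} (xi : bcds_noise P d Q l).

Definition noise_sigma
    (i : (unit + ('I_Q * 'I_l + ('I_Q * 'I_l + 'I_Q * 'I_l)))%type) :
    set (set T) :=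
  match i with
  | inl _ => sigma_of (latent xi)
  | inr (inl (q, i)) => sigma_of (weight xi q i)
  | inr (inr (inl (q, i))) => sigma_of (freq xi q i)
  | inr (inr (inr (q, i))) => sigma_of (phase xi q i)
  end.

Record bcds_sampled N (D : dataset R d N) : Prop := BcdsSampled {
  latent_law : has_law (latent xi) (cat_prob (p_nn m D));
  weight_law : forall q i, has_law (weight xi q i) (normal_prob 0 1);
  freq_law : forall q i,
    has_law (freq xi q i) (gauss_prob (spec_mean m q) (spec_var m q));
  phase_law : forall q i,
    has_law (phase xi q i) (uniform_prob (@twopi_gt0 R));
  noise_independent : mutually_independent P noise_sigma
}.

Definition z_cat (w : T) (q : 'I_Q) : R := tnth (latent xi w) q.

Definition phi (w : T) (q : 'I_Q) (x : 'rV[R]_d) : R :=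
  Num.sqrt (2 / l%:R) *
  \sum_(i < l) weight xi q i w *
     cos (2 * pi * inner (freq xi q i w) x + phase xi q i w).

Definition Psi (w : T) (x : 'rV[R]_d) : R :=
  \sum_(q < Q) Num.sqrt (z_cat w q) * phi w q x.

(* For a noise sampled for D, the law of [z_cat] is Cat(p_nn(D)); this is how the
   kernel, and everything built on it, depends on D through p_nn. *)
Definition expected_kernel (r : 'rV[R]_d) : R :=
  fine 'E_P[fun w => \sum_(q < Q) z_cat w q * kq q r].

Section representation.
Context {N : nat} (D : dataset R d N).

Definition data_x (n : 'I_N) : 'rV[R]_d := (tnth D n).1.
Definition data_y (n : 'I_N) : R := (tnth D n).2.

Definition gram : 'M[R]_N :=
  \matrix_(n, n') expected_kernel (data_x n - data_x n').

Definition update_coef (w : T) : 'cV[R]_N :=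
  invmx (gram + (noise_var m)%:M) *m
  (\col_n data_y n - \col_n Psi w (data_x n)).

Definition data_channel (w : T) (x : 'rV[R]_d) : R :=
  Psi w x + \sum_(n < N) update_coef w n 0 * expected_kernel (x - data_x n).

Definition density_channel (x : 'rV[R]_d) : R :=
  \sum_(n < N) expected_kernel (x - data_x n).

Definition RE (w : T) (x : 'rV[R]_d) : 'rV[R]_2 :=
  \row_(i < 2) (if i == 0 then density_channel x else data_channel w x).

Definition Phi_B (w : T) : 'rV[R]_d -> 'rV[R]_c := rho m (RE w).

End representation.

End bayesian_conv_deep_set.

Definition on_grid (R : realType) (d c M : nat) (t : 'I_M -> 'rV[R]_d)
    (h : 'rV[R]_d -> 'rV[R]_c) : M.-tuple (c.-tuple R) :=
  [tuple [tuple h (t m) 0 i | i < c] | m < M].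

(* Main.v *)
(* The expected kernel only depends on the law of [Z_cat], hence is the same for
   [D] and its translate, and x_n |-> x_n + tau is absorbed everywhere except in
   the random features, where it replaces the phase b by b + 2 pi <s, tau>.
   Reduced modulo 2 pi, the new phase is again uniform and independent of all the
   other noise, so the joint law of the noise is unchanged.  The translated
   representation is therefore the translate of the original one, computed from
   an equally distributed noise.  The map from the noise to the values of rho on
   the grid is measurable because it is continuous: the representation is jointly
   continuous in noise and evaluation point, hence continuous into functions with
   the compact-open topology, where rho is continuous. *)

Require Import Defs.
From HB Require Import structures.
From mathcomp Require Import all_boot all_order all_algebra finmap.
From mathcomp Require Import all_classical all_reals all_analysis.
From mathcomp Require Import measurable_realfun ring lra.

Set Implicit Arguments.
Unset Strict Implicit.
Unset Printing Implicit Defensive.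

Import Order.TTheory GRing.Theory Num.Theory.
Import numFieldNormedType.Exports.

Local Open Scope classical_set_scope.
Local Open Scope ring_scope.

(** * Measurability of continuous functions of finitely many measurable coordinates *)

Lemma measurable_floorM (R : realType) (a : R) :
  0 <= a -> measurable_fun setT (fun x : R => (Num.floor (a * x))%:~R : R).
Proof.
move=> a0; apply: nondecreasing_measurable => // x y xy.
by rewrite ler_int le_floor// ler_wpM2l.
Qed.

(** A floor lies less than 1 below its argument, so after division the error is below [1/(n+1)]. *)
Lemma cvg_floorM (R : realType) (x : R) :
  n.+1%:R^-1 * (Num.floor (n.+1%:R * x))%:~R @[n --> \oo] --> x.
Proof.
apply: (@squeeze_cvgr _ _ _ _ (fun n => x - n.+1%:R^-1) (fun=> x)).
- near=> n; have n0 : 0 < n.+1%:R :> R by [].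
  rewrite !(mulrC n.+1%:R^-1) ler_pdivrMr// ler_pdivlMr//.
  rewrite mulrBl mulVf ?gt_eqF// (mulrC x) floor_le andbT lerBlDr.
  by rewrite ltW// -[1]/(1%:~R) -intrD floorD1_gt.
- rewrite -[X in _ --> X]subr0; apply: cvgB; first exact: cvg_cst.
  exact: cvg_harmonic.
- exact: cvg_cst.
Unshelve. all: by end_near. Qed.

(* On the values [n.+1^-1 * floor (n.+1 * _)] the argument of [G] ranges over a
   countable set, so no measurability of [G] itself is involved. *)
Lemma measurable_continuous_coords d (S : measurableType d) (R : realType)
    (J : finType) (X : J -> S -> R) (G : {ptws J -> R} -> R) :
  (forall j, measurable_fun setT (X j)) -> continuous G ->
  measurable_fun setT (fun s => G (X ^~ s)).
Proof.
move=> mX cG.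
pose a n s := [ffun j => Num.floor (n.+1%:R * X j s)].
pose u n (c : {ffun J -> int}) : {ptws J -> R} :=
  fun j => n.+1%:R^-1 * (c j)%:~R.
apply/measurable_EFinP.
(* The function is a pointwise limit: [G] is evaluated at the coordinates rounded down to multiples
   of [1/(n+1)]. *)
apply: (@emeasurable_fun_cvg _ _ _ _ (fun n s => (G (u n (a n s)))%:E)).
  move=> n; apply/measurable_EFinP => _ B mB; rewrite setTI.
  rewrite (_ : _ @^-1` B =
    \bigcup_(c in [set c | B (G (u n c))]) (a n @^-1` [set c])); last first.
    apply/seteqP; split => [s Bs|s [c Bc] /= ->//].
    by exists (a n s).
  rewrite bigcup_mkcond; apply: countable_bigcupT_measurable => //.
  move=> c; case: ifP => // _.
  rewrite (_ : _ @^-1` _ = \bigcap_(j in setT)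
    ((fun s => (Num.floor (n.+1%:R * X j s))%:~R : R) @^-1` [set (c j)%:~R])).
    apply: fin_bigcap_measurable => // j _.
    rewrite -[X in measurable X]setTI.
    exact: (measurableT_comp (measurable_floorM (ler0n R n.+1)) (mX j)).
  apply/seteqP; split => s /= => [<- j _|h].
    by rewrite ffunE.
  by apply/ffunP => j; rewrite ffunE; exact: (@intr_inj R _ _ (h j I)).
move=> s _; apply/fine_cvgP; split; [exact: nearW|].
pose v n : {ptws J -> R} := u n (a n s).
suff cv : {ptws, v @ \oo --> (X ^~ s)}.
  exact: (cvg_comp _ _ cv (cG _)).
apply/(@pointwise_cvgP (discrete_topology J) R) => j.
have := @cvg_floorM R (X j s); rewrite (_ : (fun n => _) = (fun n => v n j)) //.
by apply/funext => n /=; rewrite /v /u ffunE.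
Qed.

(** * Uniform phases on the circle *)

Section fmodr.
Context {R : realType}.

(** The remainder of [x] modulo [p]; with [p = 2 pi] it brings a shifted phase back to [[0, 2
    pi[]. *)
Definition fmodr (p x : R) := x - p * (Num.floor (x / p))%:~R.

Lemma fmodr_itv (p x : R) : 0 < p -> 0 <= fmodr p x < p.
Proof.
move=> p0; rewrite /fmodr subr_ge0 ltrBlDr -{3}(mulr1 p) -mulrDr.
rewrite mulrC -ler_pdivlMr// floor_le/=.
by rewrite mulrC -ltr_pdivrMr// addrC -[1]/(1%:~R) -intrD floorD1_gt.
Qed.

Lemma fmodr_small (p x : R) : 0 < p -> 0 <= x < p -> fmodr p x = x.
Proof.
move=> p0 /andP[x0 xp]; rewrite /fmodr (_ : Num.floor _ = 0) ?mulr0 ?subr0//.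
by apply/floor_def; rewrite add0r divr_ge0// ?ltW//= ltr_pdivrMr// mul1r.
Qed.

Lemma fmodrDz (p x : R) (z : int) : 0 < p -> fmodr p (x + p * z%:~R) = fmodr p x.
Proof.
move=> p0; rewrite /fmodr mulrDl mulrAC divff ?gt_eqF// mul1r floorDrz ?intr_int//.
by rewrite intrKfloor intrD mulrDr opprD addrACA subrr addr0.
Qed.

Lemma fmodrDr (p x y : R) : 0 < p -> fmodr p (x + fmodr p y) = fmodr p (x + y).
Proof.
move=> p0; rewrite {2}/fmodr addrA -mulrN -intrN fmodrDz//.
Qed.

Lemma measurable_fmodr (p : R) : 0 < p -> measurable_fun setT (fmodr p).
Proof.
move=> p0; apply: measurable_funB => //; apply: measurable_funM => //.
rewrite (_ : (fun x => _) = fun x : R => (Num.floor (p^-1 * x))%:~R).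
  by apply: measurable_floorM; rewrite invr_ge0 ltW.
by apply/funext => x; rewrite mulrC.
Qed.

(** The pushforward under a translation has the right value on half-open intervals, which determines
    Lebesgue measure. *)
Lemma lebesgue_measureDl (a : R) (A : set R) : measurable A ->
  lebesgue_measure [set x | A (x + a)] = lebesgue_measure A.
Proof.
move=> mA; pose f := (fun x : measurableTypeR R => (x + a : measurableTypeR R)).
have mf : measurable_fun setT f by exact: measurable_funD.
pose mu : {measure set (measurableTypeR R) -> \bar R} :=
  measure_function_pushforward__canonical__measure_function_Measure
    (@lebesgue_measure R) mf.
suff : lebesgue_measure A = mu A by [].
apply: lebesgue_measure_unique => // X /ocitvP[->|[[x y] /= xy ->]].
  by rewrite !measure0.
rewrite /mu /= /pushforward (_ : f @^-1` _ = `](x - a), (y - a)]%classic).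
  rewrite !lebesgue_measure_itv/= !lte_fin ltrD2r; case: ifP => // _.
  by rewrite -!EFinD; congr EFin; ring.
by apply/seteqP; split => z /=; rewrite !in_itv/= /f ltrBlDr lerBrDr.
Qed.

End fmodr.

(** The density lives on [[0, p]]; the endpoint [p] is a null set, and dropping it leaves exactly
    the range of [fmodr]. *)
Lemma uniform_probE (R : realType) (p : R) (p0 : 0 < p) (A : set R) :
  measurable A ->
  uniform_prob p0 A = (p^-1%:E * lebesgue_measure (A `&` `[0%R, p[))%E.
Proof.
move=> mA; rewrite /uniform_prob integral_uniform_pdf.
rewrite (eq_integral (fun=> p^-1%:E)); last first.
  move=> x /set_mem[_ /=]; rewrite in_itv/= /uniform_pdf => ->.
  by rewrite subr0.
rewrite integral_cst//=; last exact: measurableI.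
congr (_ * _)%E.
have -> : A `&` `[0%R, p] = (A `&` `[0%R, p[) `|` (A `&` [set p]).
  rewrite -setIUr; congr (_ `&` _); apply/seteqP; split => x /=.
    rewrite !in_itv/= => /andP[-> ]; rewrite le_eqVlt => /predU1P[->|->].
      by right.
    by left.
  by rewrite !in_itv/= => -[/andP[-> /ltW->]//|->]; rewrite ltW//= lexx.
rewrite measureU0//; first exact: measurableI.
  exact: measurableI.
apply/eqP; rewrite eq_le measure_ge0 andbT.
rewrite -(lebesgue_measure_set1 p) le_measure// ?inE//.
exact: measurableI.
Qed.

(* For [t] in [0, p[, the preimage of [A] splits at [p - t] into pieces that
   translate onto [A] on [t, p[ and on [0, t[. *)
Lemma uniform_prob_fmodr (R : realType) (p : R) (p0 : 0 < p) (t : R)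
    (A : set R) : measurable A ->
  uniform_prob p0 [set x | A (fmodr p (x + t))] = uniform_prob p0 A.
Proof.
(* Only [t] modulo [p] matters, so [t] may be taken in [[0, p[]. *)
move=> mA; rewrite (_ : [set x | _] = [set x | A (fmodr p (x + fmodr p t))]).
  have := fmodr_itv t p0; move: (fmodr p t) => {}t /andP[t0 tp].
  rewrite !uniform_probE//; last first.
    rewrite -[X in measurable X]setTI.
    apply: (measurableT_comp (measurable_fmodr p0)) => //.
    exact: measurable_funD.
  congr (_ * _)%E.
  have mA1 : measurable (A `&` `[t, p[) by exact: measurableI.
  have mA2 : measurable (A `&` `[0%R, t[) by exact: measurableI.
  have mshift (a : R) (B : set R) : measurable B -> measurable [set x | B (x + a)].
    have ma : measurable_fun setT (fun x : R => x + a) by exact: measurable_funD.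
    by move=> mB; have := ma measurableT B mB; rewrite setTI.
  transitivity (lebesgue_measure (A `&` `[t, p[) +
                lebesgue_measure (A `&` `[0%R, t[))%E; last first.
    rewrite -measureU//; last first.
      apply/seteqP; split => x //= [[_ +] [_]]; rewrite !in_itv/=; lra.
    congr lebesgue_measure; apply/seteqP; split => x /=; rewrite !in_itv/=.
      by case=> -[Ax /andP[? ?]]; split => //; apply/andP; split; lra.
    move=> [Ax /andP[x0 xp]]; have [xt|tx] := ltP x t; [right|left].
      by split => //; apply/andP.
    by split => //; apply/andP.
  rewrite -(lebesgue_measureDl t mA1) -(lebesgue_measureDl (t - p) mA2).
  rewrite -measureU; [|exact: mshift|exact: mshift|]; last first.
    apply/seteqP; split => x //= [[_ +] [_]]; rewrite !in_itv/=; lra.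
  congr lebesgue_measure; apply/seteqP; split => x /=; rewrite !in_itv/=.
    move=> [+ /andP[x0 xp]]; have [xt|tx] := ltP (x + t) p.
      rewrite fmodr_small//; last by lra.
      by move=> Ax; left; split => //; lra.
    rewrite (_ : x + t = x + (t - p) + p * 1%:~R); last by ring.
    rewrite fmodrDz// fmodr_small//; last by lra.
    by move=> Ax; right; split => //; lra.
  case=> -[Ax /andP[x1 x2]]; split; try lra.
    by rewrite fmodr_small//; lra.
  rewrite (_ : x + t = x + (t - p) + p * 1%:~R); last by ring.
  by rewrite fmodrDz// fmodr_small//; lra.
by apply/seteqP; split => x /=; rewrite fmodrDr.
Qed.

(** * Continuity of the spectral kernels *)

Lemma measurable_tnthR (R : realType) n (j : 'I_n) :
  measurable_fun setT (fun t : n.-tuple R => tnth t j).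
Proof. exact: measurable_tnth. Qed.

Lemma measurable_prod_normal_pdf (R : realType) n (mu sg : 'I_n -> R) :
  measurable_fun setT (fun t : n.-tuple R => \prod_j normal_pdf (mu j) (sg j) (tnth t j)).
Proof.
apply: measurable_prod => j _.
apply: (measurableT_comp (measurable_normal_pdf (mu j) (sg j))).
exact: measurable_tnthR.
Qed.

(** Induction on the dimension: [lebesgue_tuple] in dimension [n+1] is the image of a product
    measure, so Tonelli splits off the first factor. In dimension 0 it is a Dirac mass and the
    product is empty. *)
Lemma integral_prod_normal_pdf (R : realType) n (mu sg : 'I_n -> R) :
  (\int[@lebesgue_tuple R n]_t
     (\prod_j normal_pdf (mu j) (sg j) (tnth t j))%:E = 1)%E.
Proof.
elim: n mu sg => [|n IH] mu sg.
  rewrite integral_dirac//; last first.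
    by apply/measurable_EFinP; exact: measurable_prod_normal_pdf.
  by rewrite diracT mul1e big_ord0.
transitivity (\int[pushforward (@lebesgue_measure R \x lebesgue_tuple n) (@tcons R n)]_t
     (\prod_j normal_pdf (mu j) (sg j) (tnth t j))%:E)%E; first by [].
rewrite ge0_integral_pushforward//; last 3 first.
- exact: measurable_tcons.
- by apply/measurable_EFinP; exact: measurable_prod_normal_pdf.
- by move=> t _; rewrite lee_fin prodr_ge0// => j _; exact: normal_pdf_ge0.
rewrite preimage_setT fubini_tonelli1/=; last 2 first.
- apply/measurable_EFinP; apply: (measurableT_comp (measurable_prod_normal_pdf mu sg)).
  exact: measurable_tcons.
- by move=> t; rewrite lee_fin prodr_ge0// => j _; exact: normal_pdf_ge0.
rewrite -(integral_normal_pdf (mu ord0) (sg ord0)); apply: eq_integral => x _.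
rewrite /fubini_F/=.
pose sg' j := sg (lift ord0 j); pose mu' j := mu (lift ord0 j).
rewrite (eq_integral (fun t : n.-tuple R => (normal_pdf (mu ord0) (sg ord0) x)%:E *
    (\prod_j normal_pdf (mu' j) (sg' j) (tnth t j))%:E)%E); last first.
  move=> t _; rewrite big_ord_recl/= EFinM; congr (_ * EFin _)%E.
  by apply: eq_bigr => j _; rewrite tnthS.
rewrite ge0_integralZl//=.
- by rewrite IH mule1.
- by apply/measurable_EFinP; exact: measurable_prod_normal_pdf.
- by move=> t _; rewrite lee_fin prodr_ge0// => j _; exact: normal_pdf_ge0.
- by rewrite lee_fin normal_pdf_ge0.
Qed.

(** Were continuity to fail for some [e], points within [1/(n+1)] of [x] whose values stay [e] away
    from [f x] would form a sequence contradicting the hypothesis. This gives access to dominated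
    convergence, which is about sequences. *)
Lemma continuous_seq (R : realType) (V : normedModType R) (f : V -> R) (x : V) :
  (forall u : V^nat, u @ \oo --> x -> f (u n) @[n --> \oo] --> f x) ->
  {for x, continuous f}.
Proof.
move=> H; apply/cvgrPdist_lt => e e0.
have [//|nfx] := pselect (\forall y \near x, `|f x - f y| < e).
have hu n : exists y, `|x - y| < n.+1%:R^-1 /\ e <= `|f x - f y|.
  apply: contrapT => nh; apply: nfx.
  have n0 : 0 < n.+1%:R^-1 :> R by rewrite invr_gt0.
  have /cvgrPdist_lt/(_ _ n0) : y @[y --> x] --> x by exact: cvg_id.
  apply: filterS => y xy.
  by rewrite ltNge; apply/negP => h; apply: nh; exists y.
have [u hu'] := choice hu.
have ux : u @ \oo --> x.
  apply/cvgrPdist_lt => d d0.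
  have /cvgrPdist_lt/(_ _ d0) : @harmonic R @ \oo --> 0 by exact: cvg_harmonic.
  apply: filterS => n.
  rewrite sub0r normrN ger0_norm ?invr_ge0//; apply: le_lt_trans.
  by apply/ltW; case: (hu' n).
have /cvgrPdist_lt/(_ _ e0)[n _ /(_ n (leqnn n))] := H u ux.
by case: (hu' n) => _; rewrite leNgt => /negP.
Unshelve. all: by end_near. Qed.

Section kernel.
Context {R : realType} {d Q c : nat} (m : bcds_model R d Q c).

Lemma inner_continuous (s : d.-tuple R) : continuous (inner s).
Proof.
apply: continuous_big => [|j _ x]; first exact: add_continuous.
apply: (@continuousM _ _ (cst (tnth s j)) (fun x : 'rV[R]_d => x 0 j)).
  exact: cst_continuous.
exact: coord_continuous.
Qed.

Lemma measurable_inner (x : 'rV[R]_d) :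
  measurable_fun setT (fun s : d.-tuple R => inner s x).
Proof.
apply: measurable_sum => j; apply: measurable_funM => //.
exact: measurable_tnthR.
Qed.

(** Dominated convergence: the cosine is bounded by 1, so the Gaussian density, of integral 1,
    dominates the integrand for all [r] at once. *)
Lemma kq_continuous q : continuous (kq m q).
Proof.
pose mu := lebesgue_tuple (R:=R) d.
pose g s := gauss_pdf (spec_mean m q) (spec_var m q) s.
have g0 s : 0 <= g s.
  by rewrite /g /gauss_pdf prodr_ge0// => j _; exact: normal_pdf_ge0.
have mg : measurable_fun setT g by exact: measurable_prod_normal_pdf.
have ig : mu.-integrable setT (EFin \o g).
  apply/integrableP; split; first exact/measurable_EFinP.
  under eq_integral do rewrite /= ger0_norm//.
  by rewrite integral_prod_normal_pdf ltry.
have mF r : measurable_fun setT (fun s => (cos (2 * pi * inner s r) * g s)%:E).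
  apply/measurable_EFinP; apply: measurable_funM => //.
  apply: (measurableT_comp (f := cos)).
    by apply: continuous_measurable_fun; exact: continuous_cos.
  by apply: measurable_funM => //; exact: measurable_inner.
have Fg r s : (`|(cos (2 * pi * inner s r) * g s)%:E| <= (g s)%:E)%E.
  rewrite lee_fin normrM (ger0_norm (g0 s)) ler_piMl// ler_norml.
  by rewrite cos_geN1 cos_le1.
move=> r; apply: continuous_seq => u ur.
have cvgF s : setT s -> (cos (2 * pi * inner s (u n)) * g s)%:E @[n --> \oo] -->
    (cos (2 * pi * inner s r) * g s)%:E.
  move=> _; apply/fine_cvgP; split; [exact: nearW|].
  apply: cvgM; last exact: cvg_cst.
  apply: (cvg_comp _ cos); last exact: continuous_cos.
  apply: cvgM; first exact: cvg_cst.
  exact: (cvg_comp _ (inner s) ur (@inner_continuous s r)).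
have [iF _ cF] := @dominated_convergence _ _ _ mu setT measurableT
  (fun n s => (cos (2 * pi * inner s (u n)) * g s)%:E)
  (fun s => (cos (2 * pi * inner s r) * g s)%:E) (EFin \o g)
  (fun n => mF (u n)) (mF r) (aeW _ cvgF) ig (aeW _ (fun s n _ => Fg (u n) s)).
by apply: fine_cvg; rewrite fineK//; exact: integrable_fin_num.
Qed.

End kernel.

(** * The expected kernel *)

Lemma measurable_tuple1 (R : realType) n (z : n.-tuple R) : measurable [set z].
Proof.
rewrite (_ : [set z] = \bigcap_(j in setT) ((fun t => tnth t j) @^-1` [set tnth z j])).
  apply: fin_bigcap_measurable => // j _.
  by rewrite -[X in measurable X]setTI; exact: (@measurable_tnth _ R).
apply/seteqP; split => [_ -> //|t /= h].
by apply: eq_from_tnth => j; exact: h.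
Qed.

Lemma onehot_inj (R : realType) Q : injective (@onehot R Q).
Proof.
move=> q q' /(congr1 (fun t => tnth t q)); rewrite !tnth_mktuple eqxx.
by case: eqP => // _ /eqP; rewrite oner_eq0.
Qed.

Section expectation_cat.
Context d (R : realType) (T : measurableType d) (P : probability T R) (Q : nat).
Context (Z : {RV P >-> Q.-tuple R}) (p : 'I_Q -> R).
Hypothesis law_Z : has_law Z (cat_prob p).

Lemma cat_prob_onehot q : P (Z @^-1` [set onehot q]) = (p q)%:E.
Proof.
have /= := law_Z (measurable_tuple1 (onehot q)).
rewrite /distribution /pushforward /cat_prob => ->.
rewrite (bigD1 q)//= big1 ?adde0; last first.
  move=> j jq; rewrite diracE memNset ?mule0//= => /onehot_inj/eqP.
  exact/negP.
by rewrite diracE mem_set ?mule1.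
Qed.

(** [cat_prob] is a finite sum of Dirac masses at one-hot vectors, so the complement of these
    vectors has mass 0. *)
Lemma cat_prob_ae : {ae P, forall w, exists q, Z w = onehot q}.
Proof.
have mO : measurable (\bigcup_(q in setT) [set onehot q : Q.-tuple R]).
  by apply: fin_bigcup_measurable => // q _; exact: measurable_tuple1.
exists (Z @^-1` ~` (\bigcup_(q in setT) [set onehot q])); split.
- by apply: measurable_funPTI; exact: measurableC.
- have /= := law_Z (measurableC mO); rewrite /distribution /pushforward => ->.
  rewrite /cat_prob big1// => q _; rewrite diracE memNset ?mule0//=.
  by apply; exists q.
- by move=> w /= nh [q _ /= e]; apply: nh; exists q.
Qed.

Lemma expectation_cat (a : 'I_Q -> R) :
  ('E_P[fun w => (\sum_q tnth (Z w) q * a q)%R] = (\sum_q p q * a q)%R%:E)%E.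
Proof.
have mE q : measurable (Z @^-1` [set onehot q]).
  by apply: measurable_funPTI; exact: measurable_tuple1.
pose f q w := ((a q)%:E * (\1_(Z @^-1` [set onehot q]) w)%:E)%E.
have mf q : measurable_fun setT (f q).
  by apply: emeasurable_funM => //; exact/measurable_EFinP.
(* Where [Z] is one-hot, hence almost everywhere, the integrand is a linear combination of the
   indicators of the events [Z = onehot q]. *)
rewrite unlock (@ae_eq_integral _ _ _ _ _ (fun w => (\sum_q f q w)%E))//; last first.
- move: cat_prob_ae; apply: filterS => w [q Zw] _.
  rewrite Zw -sumEFin; apply: eq_bigr => j _.
  rewrite /f tnth_mktuple -EFinM mulrC indicE; congr (EFin (_ * _)).
  have [<-|jq] := eqVneq q j; first by rewrite mem_set.
  by rewrite memNset//= Zw => /onehot_inj e; rewrite e eqxx in jq.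
- exact: emeasurable_sum.
- apply/measurable_EFinP; apply: measurable_sum => q; apply: measurable_funM => //.
  apply: (measurableT_comp (@measurable_tnth _ R _ q)).
  exact: measurable_funPT.
have if1 q : P.-integrable setT (EFin \o \1_(Z @^-1` [set onehot q])).
  exact: integrable_indic.
rewrite integral_sum//; last by move=> q; exact: (integrableZl measurableT _ (if1 q)).
rewrite -sumEFin; apply: eq_bigr => q _.
transitivity ((a q)%:E * \int[P]_w (\1_(Z @^-1` [set onehot q]) w)%:E)%E.
  exact: (integralZl measurableT (if1 q)).
rewrite integral_indic// setIT EFinM muleC; congr (_ * _)%E.
exact: cat_prob_onehot.
Qed.

End expectation_cat.

(** This frees the kernel from the probability space: it depends on the dataset through [p_nn]
    alone. *)
Lemma expected_kernelE (R : realType) (d Q c l N : nat) (m : bcds_model R d Q c)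
    (D : dataset R d N) (disp : measure_display) (T : measurableType disp)
    (P : probability T R) (xi : bcds_noise P d Q l) (r : 'rV[R]_d) :
  has_law (latent xi) (cat_prob (p_nn m D)) ->
  expected_kernel m xi r = \sum_q p_nn m D q * kq m q r.
Proof. by move=> h; rewrite /expected_kernel (expectation_cat h). Qed.

(** * Shifting one phase *)

Section trace_law.
Context d d' (R : realType) (T : measurableType d) (U : measurableType d').
Context (P : probability T R) (H : set T) (mH : measurable H).
Context (u : T -> U).

(* The proof argument is what lets the measure structure be inferred. *)
Definition trace_law of measurable_fun setT u := pushforward (mrestr P mH) u.

Variable mu : measurable_fun setT u.

Let traceM : {measure set U -> \bar R} :=
  measure_function_pushforward__canonical__measure_function_Measure
    (mrestr P mH) mu.

HB.instance Definition _ := isMeasure.Build _ _ _ (trace_law mu)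
  (measure0 traceM) (measure_ge0 traceM) (@measure_semi_sigma_additive _ _ _ traceM).

Let trace_fin : fin_num_fun (trace_law mu).
Proof.
move=> A mA; rewrite /trace_law /pushforward /mrestr fin_num_measure//.
by apply: measurableI => //; rewrite -[X in measurable X]setTI; exact: mu.
Qed.

HB.instance Definition _ := Measure_isFinite.Build _ _ _ (trace_law mu) trace_fin.

End trace_law.

Section shift.
Context d d' (R : realType) (T : measurableType d) (U : measurableType d').
Context (P : probability T R) (H : set T) (u : T -> U) (b : T -> R).
Context (p : R) (p0 : 0 < p) (th : U -> R).
Hypotheses (mH : measurable H) (mu : measurable_fun setT u)
  (mb : measurable_fun setT b) (mth : measurable_fun setT th).
Hypothesis indep : forall C E, measurable C -> measurable E ->
  P (H `&` (u @^-1` C `&` b @^-1` E)) =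
  (P (H `&` u @^-1` C) * uniform_prob p0 E)%E.

(** On [H], the pair [(u, b)] has a product law with uniform second factor. Once [u] is fixed, the
    shift [th u] is a constant, under which the uniform law is invariant. *)
Lemma uniform_shift (E : set R) : measurable E ->
  P (H `&` [set w | E (fmodr p (b w + th (u w)))]) = (P H * uniform_prob p0 E)%E.
Proof.
move=> mE; pose ub w : U * measurableTypeR R := (u w, b w).
have mub : measurable_fun setT ub by exact: measurable_fun_pair.
pose F := [set x : U * measurableTypeR R | E (fmodr p (x.2 + th x.1))].
have mF : measurable F.
  rewrite -[X in measurable X]setTI.
  apply: (measurableT_comp (measurable_fmodr p0)) => //.
  apply: measurable_funD => //; exact: measurableT_comp.
transitivity (trace_law P mH mub F).
  by rewrite /trace_law /pushforward /mrestr setIC.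
(* [indep] is the agreement of both measures on rectangles, which identifies the joint law with the
   product. *)
have <- := @product_measure_unique _ _ _ _ _ (trace_law P mH mu) (uniform_prob p0)
  (trace_law P mH mub) _ F mF; last first.
  move=> C C' mC mC'; transitivity (P (H `&` (u @^-1` C `&` b @^-1` C'))).
    by rewrite setIC.
  by rewrite indep//; congr (P _ * _)%E; rewrite setIC.
transitivity (\int[trace_law P mH mu]_x (cst (uniform_prob p0 E) x))%E.
  apply: eq_integral => x _ /=; rewrite -(uniform_prob_fmodr p0 (th x) mE).
  congr (uniform_prob p0 _); apply/seteqP; split => y /=.
    by move/xsectionP.
  by move=> h; apply/xsectionP.
rewrite integral_cst//= muleC /trace_law /pushforward /mrestr.
by rewrite preimage_setT setTI.
Qed.

End shift.

(** * Joint law of the noise *)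

Section cylinders.
Context (K : finType) (S : pointedType) (cyl : K -> set (set S)).

(** With [cyl i] the events about coordinate [i], the boxes form a pi-system generating the product
    sigma-algebra; the coordinates may have different types. *)
Definition boxes : set (set S) :=
  [set A | exists2 E : K -> set S, (forall i, cyl i (E i)) &
    A = \bigcap_(i in setT) E i].

Notation BT := (g_sigma_algebraType boxes).

Hypothesis cylI : forall i, setI_closed (cyl i).
Hypothesis cylT : forall i, cyl i setT.

Lemma boxesI : setI_closed boxes.
Proof.
move=> _ _ [E1 c1 ->] [E2 c2 ->]; exists (fun i => E1 i `&` E2 i).
  by move=> i; exact: cylI.
by rewrite bigcapI.
Qed.

Lemma boxesT : boxes setT.
Proof. by exists (fun=> setT) => //; rewrite bigcapT. Qed.

Definition upd (E : K -> set S) j A i := if i == j then A else E i.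

Lemma upd_cyl E j A : (forall i, cyl i (E i)) -> cyl j A ->
  forall i, cyl i (upd E j A i).
Proof. by move=> cE cA i; rewrite /upd; case: eqVneq => [->|]. Qed.

(** Isolates the constraint on coordinate [j]: the entry [setT] leaves this coordinate free. *)
Lemma bigcap_upd E j A : \bigcap_(i in setT) upd E j A i =
  \bigcap_(i in setT) upd E j setT i `&` A.
Proof.
apply/seteqP; split => [x h|x [h Ax] i _].
  split; last by have := h j I; rewrite /upd eqxx.
  by move=> i _; have := h i I; rewrite /upd; case: ifP.
by have := h i I; rewrite /upd; case: ifP.
Qed.

Lemma bigcap_updI E j A : \bigcap_(i in setT) upd E j (E j `&` A) i =
  \bigcap_(i in setT) E i `&` A.
Proof.
apply/seteqP; split => [x h|x [h Ax] i _].
  split; last by have := h j I; rewrite /upd eqxx => -[].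
  by move=> i _; have := h i I; rewrite /upd; case: eqVneq => [-> []|].
by rewrite /upd; case: eqVneq => _; [split => //|]; exact: h.
Qed.

Lemma boxes_cyl i A : cyl i A -> boxes A.
Proof.
move=> cA; exists (upd (fun=> setT) i A); first exact: upd_cyl.
apply/seteqP; split => [x Ax j _|x /(_ i I)]; rewrite /upd ?eqxx//.
by case: ifP.
Qed.

Lemma measurable_fun_boxes d (T : measurableType d) (X : T -> BT) :
  (forall i A, cyl i A -> measurable (X @^-1` A)) -> measurable_fun setT X.
Proof.
move=> h; apply: (@measurability _ _ _ _ setT X boxes) => // _ [_ [E cE ->] <-].
rewrite setTI preimage_bigcap; apply: fin_bigcap_measurable => // i _.
exact: h.
Qed.

(** Stated for the whole family only: as [setT] is a cylinder, subfamilies are covered by entries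
    [setT]. *)
Definition indep_coords d (T : measurableType d) (R : realType)
    (P : probability T R) (X : T -> S) : Prop :=
  forall E : K -> set S, (forall i, cyl i (E i)) ->
    P (X @^-1` \bigcap_(i in setT) E i) = (\prod_i P (X @^-1` E i))%E.

(** Uniqueness of finite measures on a generating pi-system, with the constant cover by [setT]. *)
Lemma eq_law_boxes d1 (T1 : measurableType d1) d2 (T2 : measurableType d2)
    (R : realType) (P1 : probability T1 R) (P2 : probability T2 R)
    (X1 : T1 -> BT) (X2 : T2 -> BT) :
  measurable_fun setT X1 -> measurable_fun setT X2 ->
  (forall A, boxes A -> P1 (X1 @^-1` A) = P2 (X2 @^-1` A)) ->
  forall A : set BT, measurable A -> P1 (X1 @^-1` A) = P2 (X2 @^-1` A).
Proof.
move=> mX1 mX2 h A mA.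
pose m1 : {measure set BT -> \bar R} :=
  measure_function_pushforward__canonical__measure_function_Measure P1 mX1.
pose m2 : {measure set BT -> \bar R} :=
  measure_function_pushforward__canonical__measure_function_Measure P2 mX2.
apply: (@g_sigma_algebra_measure_unique _ R BT boxes _ (fun=> setT) _ _ m1 m2).
- by move=> ? ?; exact: sub_sigma_algebra.
- by move=> _; exact: boxesT.
- by rewrite bigcup_const//; exists 0%N.
- exact: boxesI.
- exact: h.
- by move=> _; rewrite /m1/= /pushforward preimage_setT probability_setT ltry.
- exact: mA.
Qed.

Lemma indep_coords_eq d1 (T1 : measurableType d1) d2 (T2 : measurableType d2)
    (R : realType) (P1 : probability T1 R) (P2 : probability T2 R)
    (X1 : T1 -> S) (X2 : T2 -> S) :
  indep_coords P1 X1 -> indep_coords P2 X2 ->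
  (forall i A, cyl i A -> P1 (X1 @^-1` A) = P2 (X2 @^-1` A)) ->
  forall A, boxes A -> P1 (X1 @^-1` A) = P2 (X2 @^-1` A).
Proof.
move=> i1 i2 h _ [E cE ->]; rewrite i1// i2//.
by apply: eq_bigr => i _; exact: h.
Qed.

(** Both sides are the product over all coordinates, since a free coordinate contributes the factor
    1. *)
Lemma indep_coords_split d (T : measurableType d) (R : realType)
    (P : probability T R) (X : T -> S) E j A :
  indep_coords P X -> (forall i, cyl i (E i)) -> cyl j A ->
  P (X @^-1` (\bigcap_(i in setT) upd E j setT i `&` A)) =
  (P (X @^-1` \bigcap_(i in setT) upd E j setT i) * P (X @^-1` A))%E.
Proof.
move=> iX cE cA; rewrite -bigcap_upd !iX; [|exact: upd_cyl..].
rewrite (bigD1 j)//= [in RHS](bigD1 j)//= /upd eqxx preimage_setT probability_setT.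
rewrite mul1e muleC; congr (_ * _)%E.
by apply: eq_bigr => i /negbTE ->.
Qed.

End cylinders.

(** * The noise space and the shift of its phases *)

Section noise_space.
Context (R : realType) (d Q l : nat).

(* The components are (z_cat, weights, frequencies, phases). *)
Definition noise_space : Type :=
  (Q.-tuple R * ('I_Q * 'I_l -> R) * ('I_Q * 'I_l -> d.-tuple R) *
   ('I_Q * 'I_l -> R))%type.

Let J : finType := (unit + ('I_Q * 'I_l + ('I_Q * 'I_l + 'I_Q * 'I_l)))%type.

(** The index type is that of [noise_sigma], so that independence of the noise transfers to these
    cylinders. *)
Definition noise_cyl (i : J) : set (set noise_space) :=
  match i with
  | inl _ => preimage_set_system setT (fun x => x.1.1.1) measurable
  | inr (inl k) => preimage_set_system setT (fun x => x.1.1.2 k) measurable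
  | inr (inr (inl k)) => preimage_set_system setT (fun x => x.1.2 k) measurable
  | inr (inr (inr k)) => preimage_set_system setT (fun x => x.2 k) measurable
  end.

Lemma noise_cylI i : setI_closed (noise_cyl i).
Proof.
by case: i => [?|[?|[?|?]]] _ _ [A mA <-] [B mB <-]; exists (A `&` B);
  rewrite ?setTI//; exact: measurableI.
Qed.

Lemma noise_cylT i : noise_cyl i setT.
Proof. by case: i => [?|[?|[?|?]]]; exists setT => //; rewrite setTI. Qed.

Notation BT := (g_sigma_algebraType (boxes noise_cyl)).

Lemma measurable_noise_cyl i (A : set BT) : noise_cyl i A -> measurable A.
Proof. by move=> /(boxes_cyl noise_cylT) ?; exact: sub_sigma_algebra. Qed.

Lemma measurable_latent : measurable_fun setT (fun x : BT => x.1.1.1).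
Proof. by move=> _ A mA; apply: (@measurable_noise_cyl (inl tt)); exists A. Qed.

Lemma measurable_weight k : measurable_fun setT (fun x : BT => x.1.1.2 k).
Proof. by move=> _ A mA; apply: (@measurable_noise_cyl (inr (inl k))); exists A. Qed.

Lemma measurable_freq k : measurable_fun setT (fun x : BT => x.1.2 k).
Proof.
by move=> _ A mA; apply: (@measurable_noise_cyl (inr (inr (inl k)))); exists A.
Qed.

Lemma measurable_phase k : measurable_fun setT (fun x : BT => x.2 k).
Proof.
by move=> _ A mA; apply: (@measurable_noise_cyl (inr (inr (inr k)))); exists A.
Qed.

(** The list [s] of phases to shift allows an induction that shifts one phase at a time. *)
Definition shift_phase (th : d.-tuple R -> R) (s : seq ('I_Q * 'I_l))
    (x : noise_space) : noise_space :=
  (x.1, fun k => if k \in s then fmodr (2 * pi) (x.2 k + th (x.1.2 k)) else x.2 k).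

Lemma measurable_shift_phase th s : measurable_fun setT th ->
  measurable_fun setT (shift_phase th s : BT -> BT).
Proof.
move=> mth; apply: measurable_fun_boxes => -[u|[k|[k|k]]] _ [B mB <-]; rewrite setTI.
- by apply: (@measurable_noise_cyl (inl u)); exists B => //; rewrite setTI.
- by apply: (@measurable_noise_cyl (inr (inl k))); exists B => //; rewrite setTI.
- by apply: (@measurable_noise_cyl (inr (inr (inl k)))); exists B => //;
    rewrite setTI.
have [ks|ks] := boolP (k \in s); last first.
  rewrite (_ : _ @^-1` _ = (fun x : BT => x.2 k) @^-1` B).
    by rewrite -[X in measurable X]setTI; exact: measurable_phase.
  by apply/seteqP; split => x /=; rewrite (negbTE ks).
rewrite (_ : _ @^-1` _ =
  (fun x : BT => fmodr (2 * pi) (x.2 k + th (x.1.2 k))) @^-1` B); last first.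
  by apply/seteqP; split => x /=; rewrite ks.
have mph : measurable_fun setT
    (fun x : BT => fmodr (2 * pi) (x.2 k + th (x.1.2 k))).
  apply: (measurableT_comp (g := fun x : BT => x.2 k + th (x.1.2 k))).
    exact: (measurable_fmodr twopi_gt0).
  apply: measurable_funD; first exact: measurable_phase.
  by apply: (measurableT_comp mth); exact: measurable_freq.
by have := mph measurableT B mB; rewrite setTI.
Qed.

Context (disp : measure_display) (T : measurableType disp) (P : probability T R).
Variable X : T -> BT.
Hypothesis mX : measurable_fun setT X.
Hypothesis indepX : indep_coords noise_cyl P X.
Hypothesis phaseX : forall k (A : set R), measurable A ->
  P [set w | A ((X w).2 k)] = uniform_prob (@twopi_gt0 R) A.

(** On boxes, this is [uniform_shift]: phase [k] is uniform and independent of everything else,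
    including the frequency that determines its shift. *)
Lemma shift_phase1_law th k : measurable_fun setT th ->
  forall A : set BT, measurable A ->
    P ((shift_phase th [:: k] \o X) @^-1` A) = P (X @^-1` A).
Proof.
move=> mth; apply: (eq_law_boxes noise_cylI noise_cylT) => //.
  exact: (measurableT_comp (measurable_shift_phase [:: k] mth)).
pose b : J := inr (inr (inr k)); pose f : J := inr (inr (inl k)).
move=> _ [E cE ->].
have [B mB EbB] := cE b; rewrite setTI in EbB.
pose H := \bigcap_(i in setT) upd E b setT i.
have EH : \bigcap_(i in setT) E i = H `&` E b.
  rewrite -bigcap_upd; apply: eq_bigcapr => i _.
  by rewrite /upd; case: eqVneq => [->|].
have cEb := upd_cyl cE (noise_cylT b).
have mH : measurable (H : set BT).
  apply: fin_bigcap_measurable => [|i _]; first exact: (@finite_finset J).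
  exact: measurable_noise_cyl (cEb i).
have mXH : measurable (X @^-1` H) by rewrite -[X in measurable X]setTI; exact: mX.
have phaseb : forall A, measurable A -> P (X @^-1` ((fun x => x.2 k) @^-1` A)) =
    uniform_prob (@twopi_gt0 R) A by move=> A; exact: phaseX.
(* The shift changes phase [k] alone, which [H] leaves free, so it only affects the condition
   [B]. *)
transitivity (P (X @^-1` H `&`
    [set w | B (fmodr (2 * pi) ((X w).2 k + th ((X w).1.2 k)))])).
  congr (P _); rewrite EH -EbB.
  apply/seteqP; split => w /=; rewrite inE eqxx => -[Hw Bw]; split => //.
    move=> i _; have := Hw i I; rewrite /upd; case: eqVneq => // ib.
    by case: i (cE i) ib => [u|[k'|[k'|k']]] [A mA <-] ib; rewrite ?setTI//=
      inE ifN//; apply: contra ib => /eqP ->.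
  move=> i _; have := Hw i I; rewrite /upd; case: eqVneq => // ib.
  by case: i (cE i) ib => [u|[k'|[k'|k']]] [A mA <-] ib; rewrite ?setTI//=
    inE ifN//; apply: contra ib => /eqP ->.
transitivity (P (X @^-1` H) * uniform_prob (@twopi_gt0 R) B)%E; last first.
  rewrite EH (indep_coords_split noise_cylT indepX cE (cE b)); congr (_ * _)%E.
  by rewrite -EbB -phaseb.
apply: (uniform_shift (u := fun w => (X w).1.2 k) (b := fun w => (X w).2 k)
  (p0 := @twopi_gt0 R)) => //.
- exact: (measurableT_comp (measurable_freq k) mX).
- exact: (measurableT_comp (measurable_phase k) mX).
(* The condition [C] on the frequency is merged into entry [f] of the box, and phase [k] is then
   split off. *)
move=> C B' mC mB'.
pose Cf : set noise_space := (fun x => x.1.2 k) @^-1` C.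
pose E' := upd E f (E f `&` Cf).
have cCf : noise_cyl f Cf by exists C => //; rewrite setTI.
have cE' i : noise_cyl i (E' i).
  by apply: upd_cyl => //; apply: (@noise_cylI f) => //; exact: cE.
have HC : \bigcap_(i in setT) upd E' b setT i = H `&` Cf.
  rewrite -(bigcap_updI _ f); apply: eq_bigcapr => i _.
  have fb : (f == b) = false by [].
  by rewrite /E' /upd fb; have [->|] := eqVneq i f; rewrite ?fb.
have cB' : noise_cyl b ((fun x => x.2 k) @^-1` B') by exists B' => //; rewrite setTI.
have := indep_coords_split noise_cylT indepX cE' cB'; rewrite HC phaseb// => <-.
by rewrite setIA.
Qed.

Lemma shift_phase_law th s : measurable_fun setT th -> uniq s ->
  forall A : set BT, measurable A ->
    P ((shift_phase th s \o X) @^-1` A) = P (X @^-1` A).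
Proof.
move=> mth; elim: s => [_|k s IH /=/andP[ks us]] A mA.
  by congr (P _); apply/seteqP; split => w /=; rewrite /shift_phase/=; case: (X w).
(* The shift at [k] is composed after those in [s], so that both invariances are used for [X] itself
   and independence need not be re-established for a shifted noise. *)
rewrite -(shift_phase1_law k mth mA).
have mA' : measurable (shift_phase th [:: k] @^-1` A : set BT).
  by rewrite -[X in measurable X]setTI; exact: measurable_shift_phase.
rewrite -[RHS](IH us _ mA'); congr (P _); rewrite -comp_preimage.
congr (_ @^-1` A); apply/funext => w; rewrite /shift_phase/=; congr pair.
apply/funext => j; rewrite !inE; have [->|_] //= := eqVneq j k.
by rewrite (negbTE ks).
Qed.

End noise_space.

(** * The representation as a function of the noise *)

(** Neighbourhoods of a matrix are given entrywise, and there are finitely many entries. *)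
Lemma continuous_mx (R U : topologicalType) n p (f : U -> 'M[R]_(n, p)) :
  (forall i j, continuous (fun x => f x i j)) -> continuous f.
Proof.
move=> cf x A [B nB sBA]; rewrite /nbhs/=.
have : \forall y \near x, forall i, forall j, B i j (f y i j).
  apply: filter_forall => i; apply: filter_forall => j.
  exact: cf (nB i j).
by apply: filterS => y h; exact: sBA.
Qed.

Section continuous_algebra.
Context {R : realType} {U : topologicalType}.
Implicit Types f g : U -> R.

Lemma continuous_mulr f g : continuous f -> continuous g ->
  continuous (fun x => f x * g x).
Proof. by move=> cf cg x; apply: cvgM; [exact: cf|exact: cg]. Qed.

Lemma continuous_addr f g : continuous f -> continuous g ->
  continuous (fun x => f x + g x).
Proof. by move=> cf cg x; apply: cvgD; [exact: cf|exact: cg]. Qed.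

Lemma continuous_sumr n (f : 'I_n -> U -> R) : (forall i, continuous (f i)) ->
  continuous (fun x => \sum_i f i x).
Proof.
by move=> cf; apply: continuous_big => [|i _]; [exact: add_continuous|exact: cf].
Qed.

Lemma continuous_compr (V W : topologicalType) (h : V -> W) (f : U -> V) :
  continuous f -> continuous h -> continuous (fun x => h (f x)).
Proof. by move=> cf ch x; apply: (cvg_comp f h); [exact: cf|exact: ch]. Qed.

End continuous_algebra.

Section representation_of_noise.
Context {R : realType} {d Q c l : nat} (m : bcds_model R d Q c).
Implicit Types x : noise_space R d Q l.

(** From here on the representation is a function of a point of the noise space, with the kernel as
    a parameter: [D] and its translate can then share one map. *)
Definition phi_noise x (q : 'I_Q) (y : 'rV[R]_d) : R :=
  Num.sqrt (2 / l%:R) *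
  \sum_(i < l) x.1.1.2 (q, i) * cos (2 * pi * inner (x.1.2 (q, i)) y + x.2 (q, i)).

Definition Psi_noise x (y : 'rV[R]_d) : R :=
  \sum_(q < Q) Num.sqrt (tnth x.1.1.1 q) * phi_noise x q y.

Context (k : 'rV[R]_d -> R) (N : nat).
Implicit Types D : dataset R d N.

Definition gram_noise D : 'M[R]_N := \matrix_(n, n') k (data_x D n - data_x D n').

Definition coef_noise D x : 'cV[R]_N :=
  invmx (gram_noise D + (noise_var m)%:M) *m
  (\col_n data_y D n - \col_n Psi_noise x (data_x D n)).

Definition RE_noise D x (y : 'rV[R]_d) : 'rV[R]_2 :=
  \row_(i < 2) (if i == 0 then \sum_(n < N) k (y - data_x D n)
    else Psi_noise x y + \sum_(n < N) coef_noise D x n 0 * k (y - data_x D n)).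

Lemma data_x_translate D tau n : data_x (translate tau D) n = data_x D n + tau.
Proof. by rewrite /data_x tnth_map. Qed.

Lemma data_y_translate D tau n : data_y (translate tau D) n = data_y D n.
Proof. by rewrite /data_y tnth_map. Qed.

Lemma cosB2piz (u : R) (z : int) : cos (u - 2 * pi * z%:~R) = cos u.
Proof.
have nat_case (v : R) (n : nat) : cos (v + 2 * pi * n%:R) = cos v.
  rewrite -[RHS](periodicn (@cosD2pi R) n); congr cos.
  by rewrite -(mulr_natr (pi *+ 2)) -(mulr_natr pi 2); ring.
case: z => n.
  by rewrite -(nat_case (u - 2 * pi * n%:Z%:~R) n) -addrA addNr addr0.
by rewrite NegzE mulrNz mulrN opprK; exact: nat_case.
Qed.

Lemma innerD (s : d.-tuple R) (y z : 'rV[R]_d) : inner s (y + z) = inner s y + inner s z.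
Proof. by rewrite /inner -big_split; apply: eq_bigr => j _; rewrite mxE mulrDr. Qed.

Definition shift_all tau x : noise_space R d Q l :=
  shift_phase (fun s => 2 * pi * inner s tau) (enum {: 'I_Q * 'I_l}) x.

(** The added phase [2 pi <s, tau>] turns [<s, y>] into [<s, y + tau>]; the reduction modulo [2 pi]
    is invisible to the cosine. *)
Lemma phi_noise_shift x q tau y :
  phi_noise (shift_all tau x) q y = phi_noise x q (y + tau).
Proof.
congr (_ * _); apply: eq_bigr => i _; rewrite /shift_all /shift_phase/= mem_enum.
by congr (_ * _); rewrite /fmodr addrA cosB2piz innerD; congr cos; ring.
Qed.

Lemma Psi_noise_shift x tau y :
  Psi_noise (shift_all tau x) y = Psi_noise x (y + tau).
Proof. by apply: eq_bigr => q _; rewrite phi_noise_shift. Qed.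

(** The Gram matrix depends on differences of inputs only, and [Psi_noise] at translated inputs is
    that of the shifted noise at the original ones, so the coefficients agree. *)
Lemma RE_noise_translate D tau x :
  RE_noise (translate tau D) x = translate_fun tau (RE_noise D (shift_all tau x)).
Proof.
have coefE : coef_noise (translate tau D) x = coef_noise D (shift_all tau x).
  rewrite /coef_noise; congr (invmx (_ + _) *m (_ - _)).
  - apply/matrixP => n n'; rewrite !mxE !data_x_translate; congr k.
    by rewrite opprD addrACA subrr addr0.
  - by apply/matrixP => n n'; rewrite !mxE data_y_translate.
  - by apply/matrixP => n n'; rewrite !mxE data_x_translate Psi_noise_shift.
have subE y n : y - data_x (translate tau D) n = y - tau - data_x D n.
  by rewrite data_x_translate opprD (addrC (- _)) addrA.
apply/funext => y; apply/rowP => i; rewrite !mxE; case: ifP => _.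
  by apply: eq_bigr => n _; rewrite subE.
rewrite Psi_noise_shift subrK coefE; congr (_ + _).
by apply: eq_bigr => n _; rewrite subE.
Qed.

(** * Continuity in the noise and the evaluation point *)

Hypothesis ck : continuous k.

Let J : finType := ('I_Q + ('I_Q * 'I_l + ('I_Q * 'I_l * 'I_d + 'I_Q * 'I_l)))%type.

Let U : topologicalType := ({ptws J -> R} * 'rV[R]_d)%type.

(** Flattens the noise into finitely many reals, which gives it the product topology. *)
Definition noise_coord x (j : J) : R :=
  match j with
  | inl q => tnth x.1.1.1 q
  | inr (inl a) => x.1.1.2 a
  | inr (inr (inl (a, i))) => tnth (x.1.2 a) i
  | inr (inr (inr a)) => x.2 a
  end.

Definition of_coord (u : {ptws J -> R}) : noise_space R d Q l :=
  ([tuple u (inl q) | q < Q], fun a => u (inr (inl a)),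
   fun a => [tuple u (inr (inr (inl (a, i)))) | i < d],
   fun a => u (inr (inr (inr a)))).

Lemma noise_coordK x : of_coord (noise_coord x) = x.
Proof.
case: x => [[[z w] s] b]; rewrite /of_coord/=; congr (_, _, _, _).
- by apply: eq_from_tnth => q; rewrite tnth_mktuple.
- by apply/funext => a; apply: eq_from_tnth => i; rewrite tnth_mktuple.
Qed.

Lemma measurable_noise_coord j :
  measurable_fun setT
    (fun x : g_sigma_algebraType (boxes (@noise_cyl R d Q l)) => noise_coord x j).
Proof.
case: j => [q|[a|[[a i]|a]]] /=.
- apply: (measurableT_comp (@measurable_tnth _ R _ q)).
  exact: measurable_latent.
- exact: measurable_weight.
- apply: (measurableT_comp (@measurable_tnth _ R _ i)).
  exact: measurable_freq.
- exact: measurable_phase.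
Qed.

Lemma continuous_coord j : continuous (fun uy : U => uy.1 j).
Proof.
apply: (@continuous_compr U {ptws J -> R} R (fun u : {ptws J -> R} => u j) fst).
  by move=> uy; exact: cvg_fst.
exact: (@proj_continuous J (fun=> R) j).
Qed.

Lemma continuous_snd : continuous (fun uy : U => uy.2).
Proof. by move=> uy; exact: cvg_snd. Qed.

(** [Y] is the second projection for the random field itself and a constant for its values at the
    data points. *)
Lemma Psi_noise_continuous (Y : U -> 'rV[R]_d) : continuous Y ->
  continuous (fun uy : U => Psi_noise (of_coord uy.1) (Y uy)).
Proof.
move=> cY.
have cz q : continuous (fun uy : U => tnth (of_coord uy.1).1.1.1 q).
  have e : (fun uy : U => tnth (of_coord uy.1).1.1.1 q) =
      (fun uy => uy.1 (inl q)) by apply/funext => uy; exact: tnth_mktuple.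
  by rewrite e; exact: continuous_coord.
have cs a i : continuous (fun uy : U => tnth ((of_coord uy.1).1.2 a) i).
  have e : (fun uy : U => tnth ((of_coord uy.1).1.2 a) i) =
      (fun uy => uy.1 (inr (inr (inl (a, i))))).
    by apply/funext => uy; exact: tnth_mktuple.
  by rewrite e; exact: continuous_coord.
have cin a : continuous (fun uy : U => inner ((of_coord uy.1).1.2 a) (Y uy)).
  apply: continuous_sumr => i; apply: continuous_mulr (cs a i) _.
  apply: (@continuous_compr U 'rV[R]_d R (fun y => y 0 i) Y) => //.
  exact: coord_continuous.
have cb a : continuous (fun uy : U => (of_coord uy.1).2 a).
  by apply: (@continuous_coord (inr (inr (inr a)))).
have cw a : continuous (fun uy : U => (of_coord uy.1).1.1.2 a).
  exact: (@continuous_coord (inr (inl a))).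
have ccos a : continuous (fun uy : U =>
    cos (2 * pi * inner ((of_coord uy.1).1.2 a) (Y uy) + (of_coord uy.1).2 a)).
  apply: (@continuous_compr U R R cos); last exact: continuous_cos.
  apply: continuous_addr (cb a).
  by apply: continuous_mulr (cin a); exact: cst_continuous.
have cphi q : continuous (fun uy : U => phi_noise (of_coord uy.1) q (Y uy)).
  apply: continuous_mulr; first exact: cst_continuous.
  apply: continuous_sumr => i.
  exact: continuous_mulr (cw (q, i)) (ccos (q, i)).
apply: continuous_sumr => q; apply: continuous_mulr (cphi q).
by apply: (@continuous_compr U R R Num.sqrt) => //; exact: sqrt_continuous.
Qed.

Lemma RE_noise_continuous D :
  continuous (fun uy : U => RE_noise D (of_coord uy.1) uy.2).
Proof.
have ckn n : continuous (fun uy : U => k (uy.2 - data_x D n)).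
  apply: (@continuous_compr U 'rV[R]_d R k) => //.
  by move=> uy; exact: (@cvgB R 'rV[R]_d U (nbhs uy) _ snd (cst (data_x D n)) uy.2
    (data_x D n) (@continuous_snd uy) (cvg_cst _)).
have ccoef n : continuous (fun uy : U => coef_noise D (of_coord uy.1) n 0).
  (* The inverse does not vary with the noise, so the coefficients are fixed linear combinations of
     values of [Psi_noise]. *)
  pose M := invmx (gram_noise D + (noise_var m)%:M).
  have e : (fun uy : U => coef_noise D (of_coord uy.1) n 0) =
      (fun uy => \sum_n' M n n' *
        (data_y D n' - Psi_noise (of_coord uy.1) (data_x D n'))).
    apply/funext => uy; rewrite /coef_noise mxE; apply: eq_bigr => n' _.
    by rewrite !mxE.
  rewrite e; apply: continuous_sumr => n'; apply: continuous_mulr.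
    exact: cst_continuous.
  apply: continuous_addr; first exact: cst_continuous.
  apply: (@continuous_compr U R R -%R); last exact: opp_continuous.
  exact: (Psi_noise_continuous (Y := cst (data_x D n')) (@cst_continuous _ _ _)).
apply: (@continuous_mx R U) => i j.
have [j0|j0] := eqVneq j 0.
  have e : (fun uy : U => RE_noise D (of_coord uy.1) uy.2 i j) =
      (fun uy => \sum_(n < N) k (uy.2 - data_x D n)).
    by apply/funext => u; rewrite mxE j0.
  by rewrite e; apply: continuous_sumr.
have e : (fun uy : U => RE_noise D (of_coord uy.1) uy.2 i j) =
    (fun uy => Psi_noise (of_coord uy.1) uy.2 +
      \sum_(n < N) coef_noise D (of_coord uy.1) n 0 * k (uy.2 - data_x D n)).
  by apply/funext => u; rewrite mxE (negbTE j0).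
rewrite e; apply: continuous_addr; first exact: (Psi_noise_continuous continuous_snd).
by apply: continuous_sumr => n; exact: continuous_mulr.
Qed.

Lemma RE_noise_continuous_snd D x : continuous (RE_noise D x).
Proof.
have [_ /(_ (noise_coord x))] := continuous_curry (@RE_noise_continuous D).
by rewrite /curry/= noise_coordK.
Qed.

Lemma rho_RE_noise_continuous D y i :
  continuous (fun u : {ptws J -> R} => rho m (RE_noise D (of_coord u)) y 0 i).
Proof.
move=> u.
pose h (v : {ptws J -> R}) := RE_noise D (of_coord v).
have ch v : continuous (h v) by exact: RE_noise_continuous_snd.
have hc : {compact-open, h @ u --> h u}.
  have [hc _] := continuous_curry (@RE_noise_continuous D).
  exact: hc.
have Fh : Filter (h @ u) by exact: (@fmap_filter _ _ h (nbhs u) (nbhs_filter u)).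
(* Towards a continuous limit, compact-open convergence is uniform convergence on compact sets. *)
have hu : {family compact, h @ u --> h u}.
  exact: (proj1 (@compact_open_fam_compactP _ _ (h u) (h @ u) (ch u) Fh) hc).
have crho := proj1 (subspace_continuousP _ _) (@rho_continuous _ _ _ _ m) (h u) (ch u).
(* [rho] is continuous only within the continuous functions, where all [h v] lie. *)
have hw : h @ u --> within [set g : {family compact, 'rV[R]_d -> 'rV[R]_2} |
    continuous (g : 'rV[R]_d -> 'rV[R]_2)]
    (nbhs (h u : {family compact, 'rV[R]_d -> 'rV[R]_2})).
  by move=> A /hu; apply: (@filterS _ _ (nbhs_filter u)) => v; apply; exact: ch.
have Fr : Filter (rho m @ (h @ u)).
  by exact: (@fmap_filter _ _ (rho m) _ Fh).
have cr := @pointwise_cvg_compact_family _ _ _ (rho m (h u)) Fr (cvg_comp _ _ hw crho).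
have cy := proj1 (pointwise_cvgP _ Fr) cr y.
exact: (cvg_comp _ _ cy (@coord_continuous _ _ _ 0 i _)).
Qed.

End representation_of_noise.

(** * The law of the sampled noise *)

Section noise_law.
Context {R : realType} {d Q l : nat}.
Notation NS := (g_sigma_algebraType (boxes (@noise_cyl R d Q l))).
Context {disp : measure_display} {T : measurableType disp} {P : probability T R}.
Context (xi : bcds_noise P d Q l).

Definition noise_of (w : T) : NS :=
  (latent xi w, fun a => weight xi a.1 a.2 w, fun a => freq xi a.1 a.2 w,
   fun a => phase xi a.1 a.2 w).

Lemma noise_cyl_sigma i A : noise_cyl i A -> noise_sigma xi i (noise_of @^-1` A).
Proof.
by case: i => [?|[[? ?]|[[? ?]|[? ?]]]] [B mB <-]; exists B.
Qed.

Lemma noise_sigma_measurable i A : noise_sigma xi i A -> measurable A.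
Proof.
by case: i => [?|[[? ?]|[[? ?]|[? ?]]]] [B mB <-]; rewrite setTI;
  exact: measurable_funPTI.
Qed.

Lemma measurable_noise_of : measurable_fun setT noise_of.
Proof.
apply: measurable_fun_boxes => i A /noise_cyl_sigma.
exact: noise_sigma_measurable.
Qed.

Lemma noise_of_indep : mutually_independent P (noise_sigma xi) ->
  indep_coords (@noise_cyl R d Q l) P noise_of.
Proof.
move=> ind E cE; rewrite preimage_bigcap.
set J := (unit + ('I_Q * 'I_l + ('I_Q * 'I_l + 'I_Q * 'I_l)))%type.
(* Independence is instantiated at the finite set of all indices; only the order of the product
   remains to be matched. *)
pose K := seq_fset tt (enum {: J}).
have Kin i : i \in K by rewrite (perm_mem (seq_fset_perm _ _)) mem_undup mem_enum.
have := ind K (fun i => noise_of @^-1` E i) (fun i _ => noise_cyl_sigma (cE i)).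
rewrite (_ : [set` K] = setT); last by apply/seteqP; split => // i _; exact: Kin.
move=> ->; apply: perm_big; apply: uniq_perm => [||i].
- exact: seq_fset_uniq.
- exact: index_enum_uniq.
- by rewrite Kin mem_index_enum.
Qed.

End noise_law.

(** Independent coordinates have a joint law fixed by the marginals, of which only that of the
    latent variable involves the dataset, through [p_nn]. *)
Lemma noise_law_eq (R : realType) (d Q c l N1 N2 : nat) (m : bcds_model R d Q c)
    (D1 : dataset R d N1) (D2 : dataset R d N2)
    d1 (T1 : measurableType d1) (P1 : probability T1 R) (xi1 : bcds_noise P1 d Q l)
    d2 (T2 : measurableType d2) (P2 : probability T2 R) (xi2 : bcds_noise P2 d Q l) :
  bcds_sampled m xi1 D1 -> bcds_sampled m xi2 D2 ->
  p_nn m D1 = p_nn m D2 ->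
  forall A : set (g_sigma_algebraType (boxes (@noise_cyl R d Q l))), measurable A ->
    P1 (noise_of xi1 @^-1` A) = P2 (noise_of xi2 @^-1` A).
Proof.
move=> [Z1 W1 S1 B1 I1] [Z2 W2 S2 B2 I2] pE.
apply: (eq_law_boxes (@noise_cylI _ _ _ _) (@noise_cylT _ _ _ _)).
- exact: measurable_noise_of.
- exact: measurable_noise_of.
apply: indep_coords_eq; [exact: noise_of_indep|exact: noise_of_indep|].
case=> [?|[[q i]|[[q i]|[q i]]]] _ [A mA <-]; rewrite !setTI.
- by rewrite pE in Z1; exact: (etrans (Z1 A mA) (esym (Z2 A mA))).
- exact: (etrans (W1 q i A mA) (esym (W2 q i A mA))).
- exact: (etrans (S1 q i A mA) (esym (S2 q i A mA))).
- exact: (etrans (B1 q i A mA) (esym (B2 q i A mA))).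
Qed.

(** * Translation equivariance in distribution *)

Theorem proposition2 (R : realType) (d Q c l : nat) (m : bcds_model R d Q c)
  (N : nat) (D : dataset R d N) (tau : 'rV[R]_d)
  (M : nat) (t : 'I_M -> 'rV[R]_d)
  (disp1 : measure_display) (T1 : measurableType disp1) (P1 : probability T1 R)
  (xi1 : bcds_noise P1 d Q l)
  (disp2 : measure_display) (T2 : measurableType disp2) (P2 : probability T2 R)
  (xi2 : bcds_noise P2 d Q l) :
  bcds_sampled m xi1 (translate tau D) ->
  bcds_sampled m xi2 D ->
  eq_in_distribution P1 P2
    (fun w => on_grid t (Phi_B m xi1 (translate tau D) w))
    (fun w => on_grid t (translate_fun tau (Phi_B m xi2 D w))).
Proof.
move=> sam1 sam2.
pose NS := g_sigma_algebraType (boxes (@noise_cyl R d Q l)).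
pose k r := \sum_q p_nn m D q * kq m q r.
have ck : continuous k.
  apply: continuous_sumr => q; apply: continuous_mulr; last exact: kq_continuous.
  exact: cst_continuous.
have k1 : expected_kernel m xi1 = k.
  apply/funext => r; rewrite (expected_kernelE r (latent_law sam1)).
  by rewrite p_nn_translate.
have k2 : expected_kernel m xi2 = k.
  by apply/funext => r; rewrite (expected_kernelE r (latent_law sam2)).
(* Both sides are [F] of a noise: that of [xi2] as it stands, that of [xi1] after shifting all
   phases. *)
pose F (x : NS) := on_grid t (translate_fun tau (rho m (RE_noise m k D x))).
have mF : measurable_fun setT F.
  apply/measurable_fun_tnthP => j; apply/measurable_fun_tnthP => i.
  (* Each entry of [F] is a value of [rho] at [t j - tau], continuous in the real coordinates of the
     noise. *)
  have := measurable_continuous_coords (@measurable_noise_coord R d Q l)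
    (@rho_RE_noise_continuous R d Q c l m k N ck D (t j - tau) i).
  congr (measurable_fun _ _); apply/funext => x.
  by rewrite noise_coordK /= /F !tnth_mktuple.
have E2 : (fun w => on_grid t (translate_fun tau (Phi_B m xi2 D w))) =
    F \o noise_of xi2.
  by apply/funext => w; rewrite /= /F -k2.
have E1 : (fun w => on_grid t (Phi_B m xi1 (translate tau D) w)) =
    F \o (shift_all tau \o noise_of xi1).
  apply/funext => w; rewrite /= /F -rho_translate; last exact: RE_noise_continuous_snd.
  by rewrite -RE_noise_translate -k1.
have mth : measurable_fun setT (fun s : d.-tuple R => 2 * pi * inner s tau).
  by apply: measurable_funM => //; exact: measurable_inner.
have mS : measurable_fun setT (shift_all tau \o noise_of xi1 : T1 -> NS).
  apply: (measurableT_comp (measurable_shift_phase _ mth)).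
  exact: measurable_noise_of.
rewrite E1 E2; split.
- exact: (measurableT_comp mF mS).
- exact: (measurableT_comp mF (measurable_noise_of xi2)).
move=> A mA; have mFA : measurable (F @^-1` A).
  by rewrite -[X in measurable X]setTI; exact: mF.
rewrite /pushforward.
(* First the shift is removed under [P1], then the laws of the two noises are compared. *)
transitivity (P1 (noise_of xi1 @^-1` (F @^-1` A))).
  apply: (shift_phase_law (measurable_noise_of xi1)
    (noise_of_indep (noise_independent sam1)) _ mth (enum_uniq _) mFA).
  by move=> [q i] B mB; exact: (phase_law sam1 q i mB).
by apply: (noise_law_eq sam1 sam2); [exact: p_nn_translate|exact: mFA].
Qed.
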